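(* Let $q$ be a complex number with $0<|q|<1$, let $m\ge 2$ be an integer, and let $a,c$ be complex numbers with $c,\ a/c\notin q^{\mathbb Z}\cup\{0\}$. Define the polynomial in $x$ of degree at most $m-2$ $$f(x):=-\frac{(q/c;q)_{m-1}\,(cq^{-m};q)_{m-1}}{(aq/c;q)_{m-1}\,(q;q)_{m-1}}\,q^{m-1}\sum_{j=0}^{m-2}\frac{(q/a;q)_j\,(q^{1-m};q)_j}{(q;q)_j\,(q^2/c;q)_j}\left(\frac{aq^m x}{c}\right)^{j}{}_4\phi_3\left(q^{-j},\,q,\,a,\,cq^{-j-1};\ q^{m-j},\,aq^{-j},\,cq^{1-m};\ q,\,q\right).$$ Let $\lambda$ be any root of the polynomial ${}_2\phi_1\left(q/a,\,q^{1-m};\,q^2/c;\,q,\,aq^m x/c\right)$ in the variable $x$, which has degree at most $m-1$. Then the following hold, each whenever the series on its left-hand side converges: $${}_2\phi_1\left(a,\,q^m;\,c;\,q,\,\lambda\right)=\lambda^{1-m}f(\lambda),$$ $${}_2\phi_1\left(c/a,\,cq^{-m};\,c;\,q,\,\frac{aq^m\lambda}{c}\right)=\frac{(\lambda;q)_\infty}{(aq^m\lambda/c;q)_\infty}\,\lambda^{1-m}f(\lambda).$$ Moreover, in the case $m=2$ (with $a\ne q$, so that the root exists), one has $\lambda=\dfrac{q^2-c}{(q-a)q}$ and, again whenever the series on the left-hand side converges, $${}_2\phi_1\left(a,\,q^2;\,c;\,q,\,\frac{q^2-c}{(q-a)q}\right)=\frac{(q-a)(q-c)}{(1-q)(c-aq)},$$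 $${}_2\phi_1\left(c/a,\,cq^{-2};\,c;\,q,\,\frac{(q^2-c)aq}{(q-a)c}\right)=\frac{(\lambda;q)_\infty}{(aq^2\lambda/c;q)_\infty}\,\frac{(q-a)(q-c)}{(1-q)(c-aq)}.$$
   Context: For complex $q$ with $0<|q|<1$, put $(a;q)_\infty:=\prod_{j=0}^{\infty}(1-aq^j)$ and $(a;q)_n:=(a;q)_\infty/(aq^n;q)_\infty$, and $q^{\mathbb Z}=\{q^i: i\in\mathbb Z\}$. The basic hypergeometric series is $${}_{r+1}\phi_r(a,b_1,\dots,b_r;\,c_1,\dots,c_r;\,q,\,x):=\sum_{n=0}^\infty\frac{(a;q)_n(b_1;q)_n\cdots(b_r;q)_n}{(q;q)_n(c_1;q)_n\cdots(c_r;q)_n}x^n .$$ A series having an upper parameter $q^{-N}$ with $N$ a nonnegative integer is a finite sum (terminated at $n=N$), so the ${}_4\phi_3$ in $f$ is the finite sum over $0\le n\le j$, and ${}_2\phi_1(q/a,q^{1-m};q^2/c;q,aq^mx/c)$ is a polynomial in $x$. A non-terminating ${}_2\phi_1$ converges for $|x|<1$. If $a=q^i$ for some integer $1\le i\le m-2$, the products $(q/a;q)_j\cdot{}_4\phi_3(\cdots)$ in $f$ are understood by continuity in $a$: the factors $1-aq^{-s}$ in the denominator $(aq^{-j};q)_n$ (with $n\le j$) cancel against factors of $(q/a;q)_j=\prod_{t=1}^{j}(1-q^t/a)$. *)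

(* Defs.v *)
From HB Require Import structures.
From mathcomp Require Import all_boot all_order all_algebra.
From mathcomp Require Import all_classical all_reals all_analysis.
From mathcomp Require Import complex.

Set Implicit Arguments.
Unset Strict Implicit.
Unset Printing Implicit Defensive.

Import Order.TTheory GRing.Theory Num.Theory numFieldNormedType.Exports.

Local Open Scope classical_set_scope.
Local Open Scope ring_scope.

(* The complex numbers are R[i] for R : realType, with the topology of their
   norm. The definitions are over an arbitrary numFieldType C, because the topology
   is not inferred directly on R[i]; they are used with C := R[i]. *)

(* (a;q)_n. The finite product is used instead of the quotient
   (a;q)_oo / (a q^n;q)_oo, which is 0 / 0 when a = q^-N and n <= N. *)
Definition qpoch (C : numFieldType) (q a : C) (n : nat) : C :=
  \prod_(j < n) (1 - a * q ^+ j).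

Definition qpoch_oo (C : numFieldType) (q a : C) : C :=
  limn (fun n => qpoch q a n).

(* Coefficient of x^n in the (r+1)phi(r) series with upper parameters us and
   lower parameters ls. *)
Definition phi_coef (C : numFieldType) (r : nat) (us : r.+1.-tuple C)
    (ls : r.-tuple C) (q : C) (n : nat) : C :=
  (\prod_(u <- us) qpoch q u n) / (qpoch q q n * \prod_(l <- ls) qpoch q l n).

Definition phi_partial (C : numFieldType) (r : nat) (us : r.+1.-tuple C)
    (ls : r.-tuple C) (q x : C) : nat -> C :=
  series (fun n => phi_coef us ls q n * x ^+ n).

Definition phi_converges (C : numFieldType) (r : nat) (us : r.+1.-tuple C)
    (ls : r.-tuple C) (q x : C) : Prop :=
  cvgn (phi_partial us ls q x).

(* Meaningful only under phi_converges. *)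
Definition phi (C : numFieldType) (r : nat) (us : r.+1.-tuple C)
    (ls : r.-tuple C) (q x : C) : C :=
  limn (phi_partial us ls q x).

(* The series terminated at n = N by an upper parameter q^-N, as a polynomial
   in its argument. *)
Definition phi_poly (C : numFieldType) (N r : nat) (us : r.+1.-tuple C)
    (ls : r.-tuple C) (q : C) : {poly C} :=
  \poly_(n < N.+1) phi_coef us ls q n.

(* (q/a;q)_j * 4phi3(...), read literally: inverses of zero denominators are
   0 here, so this is not the intended value if a = q^s with 1 <= s <= j. *)
Definition qpoch_phi43_raw (C : numFieldType) (m : nat) (q c : C) (j : nat)
    (a : C) : C :=
  qpoch q (q / a) j *
  (phi_poly j
     [tuple q ^ (- j%:Z); q; a; c * q ^ (- j%:Z - 1)]
     [tuple q ^ (m%:Z - j%:Z); a * q ^ (- j%:Z); c * q ^ (1 - m%:Z)] q).[q].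

(* If a = q^i with 1 <= i <= m - 2, the product is extended by continuity in
   a. *)
Definition qpoch_phi43 (C : numFieldType) (m : nat) (q c : C) (j : nat)
    (a : C) : C :=
  if [exists i : 'I_m.-1, (0 < i)%N && (a == q ^+ i)]
  then lim (qpoch_phi43_raw m q c j b @[b --> a^'])
  else qpoch_phi43_raw m q c j a.

Definition fpoly (C : numFieldType) (m : nat) (q a c : C) : {poly C} :=
  - ((qpoch q (q / c) m.-1 * qpoch q (c * q ^ (- m%:Z)) m.-1)
      / (qpoch q (a * q / c) m.-1 * qpoch q q m.-1) * q ^+ m.-1)
  *: \sum_(j < m.-1)
       (qpoch_phi43 m q c j a * qpoch q (q ^ (1 - m%:Z)) j
         / (qpoch q q j * qpoch q (q ^+ 2 / c) j))
       *: ((a * q ^+ m / c) *: 'X) ^+ j.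

(* The polynomial 2phi1(q/a, q^(1-m); q^2/c; q, a q^m x / c) in x. *)
Definition Ppoly (C : numFieldType) (m : nat) (q a c : C) : {poly C} :=
  phi_poly m.-1 [tuple q / a; q ^ (1 - m%:Z)] [tuple q ^+ 2 / c] q
    \Po ((a * q ^+ m / c) *: 'X).

(* Main.v *)
Require Import Defs.
From HB Require Import structures.
From mathcomp Require Import all_boot all_order all_algebra.
From mathcomp Require Import all_classical all_reals all_analysis.
From mathcomp Require Import complex.
From mathcomp Require Import ring.

Set Implicit Arguments.
Unset Strict Implicit.
Unset Printing Implicit Defensive.

Import Order.TTheory GRing.Theory Num.Theory numFieldNormedType.Exports.

Local Open Scope classical_set_scope.
Local Open Scope ring_scope.

(** Write n = m - 1, t = a q^m / c, y = t x, P for the polynomial whose root is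
    lambda, F(x) = 2phi1(a, q^m; c; x) and M(x) = 2phi1(a, q; c q^(-n); x).
    The theorem rests on one contiguity relation between formal power series,

      x^n F(x) = f(x) + K P(x) M(x),    K = contiguity_const q a c n.

    In degrees n and above, a coefficient of P M is a terminating balanced 3phi2,
    and the q-Saalschuetz sum turns it into a coefficient of x^n F. In degrees
    below n the left-hand side vanishes, so f is -K times the truncation of P M;
    reversing the convolution sum writes its coefficients with the 4phi3 of the
    statement (lemmas contiguous_coef, fpolyE and contiguity). At a root of P the
    last term disappears, which is the first evaluation.

    For the second evaluation, multiply the relation by
    B = 1phi0(c q^(-m) / a; y) = (x; q)_oo / (y; q)_oo. Heine's transformation
    makes B F and B M into 2phi1 series in y, so that the new relation
    (contiguity_heine) involves only series that converge for |y| < 1; it holds at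
    lambda even when |lambda| >= 1 and F diverges there. The product formula for B
    is the q-binomial theorem (q_binomial). Heine's transformation and the
    q-Saalschuetz sum are the same coefficient identity (heine_coef).

    To evaluate the formal relations at lambda it is enough that the terms of each
    series tend to 0: then a partial sum of P M differs from P(lambda) times a
    partial sum of M by a null sequence (conv_poly_series, root_evaluation). The
    terms of the auxiliary series are compared with those of the convergent series
    through the boundedness of (a; q)_n and of its inverse (bounded_qpoch); the
    same bounds show that convergence of the second series forces |y| < 1.

    Completeness of the complex numbers enters in the following form: a sequence
    whose steps are bounded by a geometric sequence converges. *)

(** * Formal power series and the coefficient form of Heine's transformation *)

(** The Cauchy product of two formal power series, given by their coefficients. *)
Definition conv (C : nzRingType) (u v : nat -> C) (n : nat) : C :=
  \sum_(i < n.+1) u i * v (n - i)%N.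

(** Below degree N a Cauchy product is a product of truncated polynomials; the
    ring laws of formal power series are inherited from {poly C} in this way. *)
Lemma conv_coefM (C : nzRingType) (u v : nat -> C) (N n : nat) :
  (n < N)%N -> conv u v n = ((\poly_(i < N) u i) * (\poly_(i < N) v i))`_n.
Proof.
move=> nN; rewrite coefM; apply: eq_bigr => i _.
by rewrite !coef_poly (leq_ltn_trans (leq_ord i) nN)
  (leq_ltn_trans (leq_subr i n) nN).
Qed.

Lemma eq_conv (C : nzRingType) (u u' v v' : nat -> C) (n : nat) :
  (forall i, (i <= n)%N -> u i = u' i) -> (forall i, (i <= n)%N -> v i = v' i) ->
  conv u v n = conv u' v' n.
Proof.
move=> eu ev; apply: eq_bigr => i _.
by rewrite eu ?ev ?leq_subr // -ltnS.
Qed.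

Lemma convC (C : comNzRingType) (u v : nat -> C) n : conv u v n = conv v u n.
Proof. by rewrite !(conv_coefM _ _ (ltnSn n)) mulrC. Qed.

Lemma convA (C : comNzRingType) (u v w : nat -> C) n :
  conv u (conv v w) n = conv (conv u v) w n.
Proof.
have trunc (x y : nat -> C) i : (i <= n)%N -> conv x y i =
    (\poly_(j < n.+1) ((\poly_(k < n.+1) x k) * (\poly_(k < n.+1) y k))`_j)`_i.
  by move=> le_in; rewrite coef_poly ltnS le_in (@conv_coefM _ _ _ n.+1).
have conv_coefMr (p q : {poly C}) : ((\poly_(j < n.+1) p`_j) * q)`_n = (p * q)`_n.
  by rewrite !coefM; apply: eq_bigr => i _; rewrite coef_poly ltn_ord.
rewrite [RHS]convC [LHS](eq_conv (fun _ _ => erefl) (trunc v w)).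
rewrite [RHS](eq_conv (fun _ _ => erefl) (trunc u v)).
rewrite convC [RHS]convC !(conv_coefM _ _ (ltnSn n)).
have E (p : {poly C}) : \poly_(i < n.+1) (\poly_(j < n.+1) p`_j)`_i =
    \poly_(i < n.+1) p`_i.
  by apply/polyP => i; rewrite !coef_poly; case: ifP => // ->.
by rewrite !E !conv_coefMr mulrC mulrA.
Qed.

Lemma convDr (C : nzRingType) (u v w : nat -> C) n :
  conv u (fun i => v i + w i) n = conv u v n + conv u w n.
Proof. by rewrite -big_split; apply: eq_bigr => i _; rewrite mulrDr. Qed.

Lemma convZr (C : comNzRingType) (k : C) (u v : nat -> C) n :
  conv u (fun i => k * v i) n = k * conv u v n.
Proof. by rewrite mulr_sumr; apply: eq_bigr => i _; rewrite mulrCA. Qed.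

Lemma conv_Xn (C : nzRingType) (k n : nat) (v : nat -> C) :
  conv (fun i => ('X^k : {poly C})`_i) v n = if (k <= n)%N then v (n - k)%N else 0.
Proof.
rewrite /conv; case: leqP => kn; last first.
  rewrite big1 // => i _; rewrite coefXn ltn_eqF ?mul0r //.
  exact: leq_ltn_trans (leq_ord i) kn.
rewrite (bigD1 (Ordinal (kn : k < n.+1)%N)) //= coefXn eqxx mul1r big1 ?addr0 //.
by move=> i /negPf ik; rewrite coefXn; move: ik; rewrite -val_eqE /= => ->; rewrite mul0r.
Qed.

Section QPochhammer.
Variables (C : numFieldType) (q : C).

Lemma qpoch0 (a : C) : qpoch q a 0 = 1.
Proof. by rewrite /qpoch big_ord0. Qed.

Lemma qpochS (a : C) n : qpoch q a n.+1 = qpoch q a n * (1 - a * q ^+ n).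
Proof. by rewrite /qpoch big_ord_recr. Qed.

Lemma qpochD (a : C) m n : qpoch q a (m + n) = qpoch q a m * qpoch q (a * q ^+ m) n.
Proof.
elim: n => [|n IH]; first by rewrite addn0 qpoch0 mulr1.
by rewrite addnS !qpochS IH exprD !mulrA.
Qed.

Lemma qpoch_neq0 (a : C) n : (forall j, a * q ^+ j != 1) -> qpoch q a n != 0.
Proof.
move=> ha; rewrite prodf_seq_neq0; apply/allP => i _ /=.
by rewrite subr_eq0 eq_sym.
Qed.

Hypothesis q_not_root1 : forall n, q ^+ n.+1 != 1.

Lemma qpochq_neq0 n : qpoch q q n != 0.
Proof. by apply: qpoch_neq0 => j; rewrite -exprS. Qed.

(** Coefficient of x^n in
    1phi0(c/(ab); abx/c) 2phi1(a, b; c; x) = 2phi1(c/a, c/b; c; abx/c);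
    equivalently, the q-Saalschuetz sum. The factors u and v each satisfy a
    first-order recurrence, and the recurrence of the right-hand side follows
    from those two because, with z = q^k, w = q^l and k + l = n,
    (1 - zw)(q - czw) = (1 - z)(q - czw^2) + z(1 - w)(q - cw). *)
Lemma heine_coef (a b c : C) (n : nat) :
  a != 0 -> b != 0 -> c != 0 -> (forall j, c * q ^+ j != 1) ->
  conv (fun k => (a * b / c) ^+ k * (qpoch q (c / (a * b)) k / qpoch q q k))
       (fun l => qpoch q a l * qpoch q b l / (qpoch q q l * qpoch q c l)) n
  = (a * b / c) ^+ n
    * (qpoch q (c / a) n * qpoch q (c / b) n / (qpoch q q n * qpoch q c n)).
Proof.
move=> a0 b0 c0 hc; set t := a * b / c.
set u := (X in conv X _ _); set v := (X in conv _ X _).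
have qn k : 1 - q ^+ k.+1 != 0 by rewrite subr_eq0 eq_sym.
have cn k : 1 - c * q ^+ k != 0 by rewrite subr_eq0 eq_sym.
have uS k : (1 - q ^+ k.+1) * u k.+1 = (t - q ^+ k) * u k.
  rewrite /u !qpochS -exprS [t ^+ _]exprS; have := qpochq_neq0 k; have := qn k.
  move: (qpoch q _ k) (qpoch q q k) => x y h1 h2.
  move: (t ^+ k) => tk; rewrite /t; by field; rewrite a0 b0 c0 h1 h2.
have vS l : (1 - q ^+ l.+1) * (1 - c * q ^+ l) * v l.+1
            = (1 - a * q ^+ l) * (1 - b * q ^+ l) * v l.
  rewrite /v !qpochS -exprS; have := qpochq_neq0 l; have := qn l.
  have := cn l; have := qpoch_neq0 l hc.
  move: (qpoch q a l) (qpoch q b l) (qpoch q q l) (qpoch q c l) => x y z w h1 h2 h3 h4.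
  by field; rewrite h1 h2 h3 h4.
have convS l : (1 - q ^+ l.+1) * (1 - c * q ^+ l) * conv u v l.+1
    = t * (1 - c / a * q ^+ l) * (1 - c / b * q ^+ l) * conv u v l.
  have -> : (1 - q ^+ l.+1) * (1 - c * q ^+ l) * conv u v l.+1
      = \sum_(i < l.+2) (1 - q ^+ i) * u i * (1 - c * q ^+ (l.+1 - i) * q ^+ l) * v (l.+1 - i)%N
      + \sum_(i < l.+2) u i * (q ^+ i * (1 - q ^+ (l.+1 - i)) * (1 - c * q ^+ (l - i)) * v (l.+1 - i)%N).
    rewrite mulr_sumr -big_split; apply: eq_bigr => i _ /=.
    have := leq_ord i; rewrite leq_eqVlt => /orP [/eqP -> | il].
      by rewrite subnn expr0; ring.
    rewrite subSn // !exprS; have -> : q ^+ l = q ^+ (l - i) * q ^+ i by rewrite -exprD subnK.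
    ring.
  (* The factors 1 - q^0 kill the terms i = 0 and i = l + 1. *)
  rewrite big_ord_recl expr0 subrr !mul0r add0r.
  rewrite [X in _ + X]big_ord_recr /= subnn expr0 subrr !(mulr0, mul0r) addr0.
  rewrite -big_split mulr_sumr; apply: eq_bigr => i _ /=.
  rewrite /bump leq0n add1n subSS uS.
  have il : (i <= l)%N := leq_ord i.
  rewrite subSn // -[q ^+ i * _ * _ * _]mulrA -[q ^+ i * _ * _]mulrA.
  rewrite [(1 - q ^+ _) * (_ * _)]mulrA vS.
  have -> : q ^+ l = q ^+ (l - i) * q ^+ i by rewrite -exprD subnK.
  rewrite /t; field.
  by rewrite a0 b0 c0.
elim: n => [|n IH].
  by rewrite /conv big_ord1 /u /v !qpoch0 !expr0 !(mulr1, mul1r) invr1 mulr1.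
apply: (mulfI (mulf_neq0 (qn n) (cn n))); rewrite convS IH.
rewrite !qpochS -exprS [t ^+ _.+1]exprS; have := qpochq_neq0 n; have := qn n.
have := cn n; have := qpoch_neq0 n hc.
move: (qpoch q _ n) (qpoch q _ n) (qpoch q q n) (qpoch q c n) => x y z w h1 h2 h3 h4.
by field; rewrite h1 h2 h3 h4 a0 b0.
Qed.

End QPochhammer.

(** * The contiguity relation *)

Section Reflection.
Variables (C : numFieldType) (q : C).
Hypothesis q0 : q != 0.

Lemma qpoch_reflect (y : C) j : y != 0 ->
  qpoch q y j = (- y) ^+ j * q ^+ 'C(j, 2) * qpoch q (q / (y * q ^+ j)) j.
Proof.
elim: j y => [|j IH] y y0; first by rewrite !qpoch0 !expr0 !mulr1.
have qj0 : q ^+ j != 0 by rewrite expf_neq0.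
rewrite -add1n qpochD qpochS qpoch0 IH; last by rewrite mulf_neq0 ?expf_neq0.
rewrite add1n qpochS binS bin1 expr0 expr1 mul1r mulr1 -[y * q * _]mulrA -exprS.
rewrite -mulNr exprMn exprD [(- y) ^+ j.+1]exprS.
have -> : q / (y * q ^+ j.+1) * q ^+ j = y^-1.
  by rewrite exprS; field; rewrite y0 q0 qj0.
field; exact: y0.
Qed.

(** Removes the last j factors of (x; q)_n. Apart from the two shifted factorials,
    x occurs only in (- x)^j, so the powers of q cancel in quotients. *)
Lemma qpoch_take (x : C) n j : x != 0 -> (j <= n)%N ->
  qpoch q x n = qpoch q x (n - j)
    * ((- x) ^+ j * q ^+ ((n - j) * j + 'C(j, 2))) * qpoch q (q / (x * q ^+ n)) j.
Proof.
move=> x0 jn; rewrite -{1}(subnK jn) qpochD [qpoch q (x * _) j]qpoch_reflect; last first.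
  by rewrite mulf_neq0 ?expf_neq0.
have -> : - (x * q ^+ (n - j)) = - x * q ^+ (n - j) by rewrite mulNr.
rewrite exprMn -exprM exprD.
have -> : x * q ^+ (n - j) * q ^+ j = x * q ^+ n by rewrite -mulrA -exprD subnK.
by rewrite !mulrA.
Qed.
End Reflection.

Section Contiguity.
Variables (C : numFieldType) (q a c : C).
Hypotheses (q0 : q != 0) (q_not_root1 : forall n, q ^+ n.+1 != 1).
Hypotheses (a0 : a != 0) (c0 : c != 0) (hc : forall i : int, c != q ^ i)
  (hac : forall i : int, a / c != q ^ i).

Lemma phi_coef21 (x y z : C) n :
  phi_coef [tuple x; y] [tuple z] q n
  = qpoch q x n * qpoch q y n / (qpoch q q n * qpoch q z n).
Proof. by rewrite /phi_coef !big_cons !big_nil !mulr1. Qed.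

Lemma phi_coef10 (x : C) n :
  phi_coef [tuple x] [tuple] q n = qpoch q x n / qpoch q q n.
Proof. by rewrite /phi_coef !big_cons !big_nil !mulr1. Qed.

Lemma qpoch_int_neq0 (x : C) (i : int) n :
  (forall i : int, x != q ^ i) -> qpoch q (x * q ^ i) n != 0.
Proof.
move=> hx; apply: qpoch_neq0 => j; apply: contra (hx (- (i + j%:Z))).
rewrite exprnP -mulrA -expfzDr // => /eqP e; rewrite -invr_expz.
by rewrite -[x](mulfK (expfz_neq0 (i + j%:Z) q0)) e mul1r.
Qed.

Lemma qpoch_nonpower_neq0 (x : C) n :
  (forall i : int, x != q ^ i) -> qpoch q x n != 0.
Proof. by move=> hx; rewrite -[x]mulr1 -(expr0z q); exact: qpoch_int_neq0. Qed.

Lemma qpoch_q2c_neq0 n : qpoch q (q ^+ 2 / c) n != 0.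
Proof.
apply: qpoch_nonpower_neq0 => i; apply: contra (hc (2 - i)) => /eqP e.
by rewrite expfzDr // -invr_expz -e invf_div mulrCA mulfV ?mulr1 ?expf_neq0.
Qed.

Lemma coef_comp_scaleX (p : {poly C}) (t : C) j :
  (p \Po (t *: 'X))`_j = p`_j * t ^+ j.
Proof.
rewrite comp_polyE coef_sum.
under eq_bigr => i _ do rewrite exprZn scalerA coefZ coefXn.
case: (ltnP j (size p)) => [jp | pj].
  rewrite (bigD1 (Ordinal jp)) //= eqxx mulr1 big1 ?addr0 // => i /negPf.
  by rewrite -val_eqE /= eq_sym => ->; rewrite mulr0.
rewrite big1 ?nth_default ?mul0r // => i _.
by rewrite gtn_eqF ?mulr0 // (leq_trans (ltn_ord i)).
Qed.

Lemma qpoch_terminates n j : (n < j)%N -> qpoch q (q ^+ n)^-1 j = 0.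
Proof.
move=> nj; apply/eqP; rewrite prodf_seq_eq0; apply/hasP.
exists (Ordinal nj); first by rewrite mem_index_enum.
by rewrite /= mulVf ?expf_neq0 // subrr.
Qed.

Lemma expq_pred n : q ^ (1 - n.+1%:Z) = (q ^+ n)^-1.
Proof. by rewrite exprnN; congr (_ ^ _); rewrite -addn1 PoszD opprD addrC subrK. Qed.

(** The formula holds in all degrees j because (q^-n; q)_j vanishes for j > n. *)
Lemma PpolyE n j : (Ppoly n.+1 q a c)`_j =
  qpoch q (q / a) j * qpoch q (q ^+ n)^-1 j / (qpoch q q j * qpoch q (q ^+ 2 / c) j)
  * (a * q ^+ n.+1 / c) ^+ j.
Proof.
rewrite /Ppoly /phi_poly coef_comp_scaleX coef_poly expq_pred /= phi_coef21.
by case: ltnP => // nj; rewrite qpoch_terminates // !(mulr0, mul0r).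
Qed.

(** Reversing (q^-n; q)_j / (q^2/c; q)_j brings the coefficients of P to the form
    required by heine_coef. *)
Lemma Ppoly_reflected n j : (j <= n)%N -> (Ppoly n.+1 q a c)`_j =
  qpoch q q n / qpoch q (c / q ^+ n.+1) n
  * ((a / q) ^+ j * (qpoch q (q / a) j / qpoch q q j))
  * (qpoch q (c / q ^+ n.+1) (n - j) / qpoch q q (n - j)).
Proof.
move=> jn; rewrite PpolyE.
rewrite [qpoch q q n](qpoch_take q0 q0 jn).
rewrite [qpoch q (c / _) n](qpoch_take q0 _ jn) ?mulf_neq0 ?invr_eq0 ?expf_neq0 //.
have -> : q / (q * q ^+ n) = (q ^+ n)^-1 by field; rewrite q0 expf_neq0.
have -> : q / (c / q ^+ n.+1 * q ^+ n) = q ^+ 2 / c.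
  by rewrite exprS; field; rewrite q0 c0 expf_neq0.
have h1 := qpochq_neq0 q_not_root1 (n - j).
have h2 := qpochq_neq0 q_not_root1 j.
have h3 := qpoch_q2c_neq0 j.
have h4 : qpoch q (c / q ^+ n.+1) (n - j) != 0.
  by rewrite exprnN; apply: qpoch_int_neq0.
have -> : (- q) ^+ j = (- (c / q ^+ n.+1)) ^+ j * (q ^+ n.+2 / c) ^+ j.
  by rewrite -exprMn; congr (_ ^+ _); rewrite [q ^+ n.+2]exprS; field; rewrite c0 expf_neq0.
have -> : (a * q ^+ n.+1 / c) ^+ j = (q ^+ n.+2 / c) ^+ j * (a / q) ^+ j.
  by rewrite -exprMn; congr (_ ^+ _); rewrite [q ^+ n.+2]exprS; field; rewrite c0 q0.
have h5 : (- (c / q ^+ n.+1)) ^+ j != 0.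
  by rewrite expf_neq0 // oppr_eq0 mulf_neq0 // invr_eq0 expf_neq0.
have h6 : q ^+ ((n - j) * j + 'C(j, 2)) != 0 by rewrite expf_neq0.
move: (qpoch q q j) (qpoch q q (n - j)) (qpoch q (q ^+ 2 / c) j) h1 h2 h3 h4 h5 h6.
move: (qpoch q (c / _) (n - j)) ((- (c / _)) ^+ j) ((_ / c) ^+ j) ((a / q) ^+ j).
move: (qpoch q (q / a) j) (qpoch q (q ^+ n)^-1 j) (q ^+ (_ + _)%N) => ? ? ? ? ? ? ? ? ? ? h1 h2 h3 h4 h5 h6.
by field; rewrite h1 h2 h3 h4 h5 h6.
Qed.

(** For N = n + k with k >= 0, M_(N-i) is M_k times a quotient of shifted
    factorials of length n - i, and the sum over i is the instance of heine_coef
    with parameters a q^k, c q^(-n-1), c q^(k-n). *)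
Lemma contiguous_coef n k :
  conv (fun i => (Ppoly n.+1 q a c)`_i) (phi_coef [tuple a; q] [tuple c / q ^+ n] q) (n + k)
  = (qpoch q (c / q ^+ n.+1) n)^-1
    * ((qpoch q (c / q ^+ n) n)^-1 * (a / q) ^+ n * qpoch q (c / (a * q ^+ n)) n)
    * (qpoch q q n * phi_coef [tuple a; q ^+ n.+1] [tuple c] q k).
Proof.
have hcn i : c / q ^+ n * q ^+ i != 1.
  apply: contra (hc (n%:Z - i%:Z)) => /eqP e.
  rewrite expfzDr // -exprnP -invr_expz -exprnP -[c](divfK (expf_neq0 n q0)).
  by rewrite mulrC -[c / _](mulfK (expf_neq0 i q0)) e mul1r.
have hcnN i : qpoch q (c / q ^+ n) i != 0 by exact: qpoch_neq0.
have hck i : c / q ^+ n * q ^+ k * q ^+ i != 1 by rewrite -mulrA -exprD.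
have vE l : phi_coef [tuple a; q] [tuple c / q ^+ n] q l = qpoch q a l / qpoch q (c / q ^+ n) l.
  by rewrite phi_coef21; field; rewrite hcnN qpochq_neq0.
have qn0 := expf_neq0 n q0; have qk0 := expf_neq0 k q0; have qn10 := expf_neq0 n.+1 q0.
have := @heine_coef _ q q_not_root1 (a * q ^+ k) (c / q ^+ n.+1) (c / q ^+ n * q ^+ k) n
  (mulf_neq0 a0 qk0) _ _ hck.
rewrite !mulf_neq0 ?invr_eq0 // => /(_ isT isT).
have -> : a * q ^+ k * (c / q ^+ n.+1) / (c / q ^+ n * q ^+ k) = a / q.
  by rewrite exprS; field; rewrite q0 qn0 qk0 c0.
have -> : c / q ^+ n * q ^+ k / (a * q ^+ k * (c / q ^+ n.+1)) = q / a.
  by rewrite exprS; field; rewrite q0 qn0 qk0 c0 a0.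
have -> : c / q ^+ n * q ^+ k / (a * q ^+ k) = c / (a * q ^+ n).
  by field; rewrite qn0 qk0 a0.
have -> : c / q ^+ n * q ^+ k / (c / q ^+ n.+1) = q * q ^+ k.
  by rewrite exprS; field; rewrite qn0 q0 c0.
move=> H.
have -> : conv (fun i => (Ppoly n.+1 q a c)`_i)
    (phi_coef [tuple a; q] [tuple c / q ^+ n] q) (n + k)
  = qpoch q q n / qpoch q (c / q ^+ n.+1) n * (qpoch q a k / qpoch q (c / q ^+ n) k)
    * conv (fun i => (a / q) ^+ i * (qpoch q (q / a) i / qpoch q q i))
           (fun l => qpoch q (a * q ^+ k) l * qpoch q (c / q ^+ n.+1) l
              / (qpoch q q l * qpoch q (c / q ^+ n * q ^+ k) l)) n.
  rewrite /conv -(big_mkord predT (fun i => (Ppoly n.+1 q a c)`_i * phi_coef [tuple a; q] [tuple c / q ^+ n] q (n + k - i))).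
  rewrite (@big_cat_nat _ _ _ n.+1) //=; last by rewrite ltnS leq_addr.
  rewrite [X in _ + X]big_nat [X in _ + X]big1 ?addr0; last first.
    by move=> i /andP[ni _]; rewrite PpolyE // qpoch_terminates // !(mulr0, mul0r).
  rewrite big_mkord mulr_sumr; apply: eq_bigr => i _.
  have le_in : (i <= n)%N := leq_ord i.
  rewrite Ppoly_reflected // vE -addnBAC // [(n - i + k)%N]addnC !qpochD.
  have h1 := qpochq_neq0 q_not_root1 (n - i).
  have h2 := qpochq_neq0 q_not_root1 i.
  have h3 : qpoch q (c / q ^+ n * q ^+ k) (n - i) != 0 by exact: qpoch_neq0.
  have h4 : qpoch q (c / q ^+ n.+1) n != 0.
    by rewrite exprnN; apply: qpoch_int_neq0.
  by field; rewrite h1 h2 h3 h4 hcnN.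
rewrite H phi_coef21.
have e1 : qpoch q q n * qpoch q (q ^+ n.+1) k = qpoch q q k * qpoch q (q * q ^+ k) n.
  by rewrite exprS -!qpochD addnC.
have e2 : qpoch q (c / q ^+ n) n * qpoch q c k
    = qpoch q (c / q ^+ n) k * qpoch q (c / q ^+ n * q ^+ k) n.
  by rewrite -qpochD addnC qpochD divfK.
have h1 := qpochq_neq0 q_not_root1 n; have h2 := qpochq_neq0 q_not_root1 k.
have h3 : qpoch q (c / q ^+ n * q ^+ k) n != 0 by exact: qpoch_neq0.
have h4 : qpoch q (c / q ^+ n.+1) n != 0.
  by rewrite exprnN; apply: qpoch_int_neq0.
have h5 : qpoch q c k != 0 by exact: qpoch_nonpower_neq0.
have h6 := hcnN n; have h7 := hcnN k.
rewrite [X in _ = X](_ : _ = (qpoch q (c / q ^+ n.+1) n)^-1 * ((a / q) ^+ n * qpoch q (c / (a * q ^+ n)) n)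
   * qpoch q a k * (qpoch q q n * qpoch q (q ^+ n.+1) k) / (qpoch q q k * (qpoch q (c / q ^+ n) n * qpoch q c k))); last by field; rewrite h2 h4 h5 h6.
rewrite e1 e2; field; by rewrite h1 h2 h3 h4 h7.
Qed.

(** The k-th term of (q/b; q)_j 4phi3(...) after (q/b; q)_j has been divided by
    (b q^-j; q)_k; unlike the quotient, it makes sense for every nonzero b. *)
Definition phi43_term (n j k : nat) (b : C) : C :=
  qpoch q (q / b) (j - k) * qpoch q b k
  * ((- (q / b)) ^+ k * q ^+ ((j - k) * k + 'C(k, 2)))
  * (qpoch q (q ^+ j)^-1 k * qpoch q (c / q ^+ j.+1) k
     / (qpoch q (q ^+ (n.+1 - j)) k * qpoch q (c / q ^+ n) k) * q ^+ k).

Lemma qpoch_phi43_rawE n j b : (j <= n)%N -> b != 0 ->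
  (forall s, (0 < s <= j)%N -> b != q ^+ s) ->
  qpoch_phi43_raw n.+1 q c j b = \sum_(k < j.+1) phi43_term n j k b.
Proof.
move=> jn b0 hb; rewrite /qpoch_phi43_raw /phi_poly horner_poly mulr_sumr.
apply: eq_bigr => k _; have kj : (k <= j)%N := leq_ord k.
have qj0 := expf_neq0 j q0.
rewrite /phi_coef !big_cons !big_nil !mulr1 /phi43_term.
have -> : q ^ (- j%:Z) = (q ^+ j)^-1 by rewrite exprnN.
have -> : c * q ^ (- j%:Z - 1) = c / q ^+ j.+1.
  by rewrite exprnN -addn1 PoszD opprD.
have -> : q ^ (n.+1%:Z - j%:Z) = q ^+ (n.+1 - j) by rewrite subzn // ltnW.
rewrite expq_pred (qpoch_take q0 _ kj) ?mulf_neq0 ?invr_eq0 //.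
have -> : q / (q / b * q ^+ j) = b / q ^+ j by field; rewrite q0 b0 qj0.
have h1 : qpoch q (b / q ^+ j) k != 0.
  rewrite prodf_seq_neq0; apply/allP => i _ /=.
  have ij : (i < j)%N := leq_trans (ltn_ord i) kj.
  rewrite subr_eq0; apply: contra (hb (j - i)%N _); last first.
    by rewrite subn_gt0 ij leq_subr.
  move=> /eqP e; rewrite -(inj_eq (mulIf (expf_neq0 i q0))) -exprD subnK ?(ltnW ij) //.
  by rewrite -(inj_eq (mulIf (invr_neq0 qj0))) mulfV // e mulrAC.
have h2 := qpochq_neq0 q_not_root1 k.
set w := _ ^+ (_ + _)%N.
have h3 : qpoch q (q ^+ (n.+1 - j)) k != 0.
  by apply: qpoch_neq0 => i; rewrite subSn // -exprD addSn.
have h4 : qpoch q (c / q ^+ n) k != 0 by rewrite exprnN; apply: qpoch_int_neq0.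
by field; rewrite h1 h2 h3 h4.
Qed.

Lemma cvg_qpoch (b : C) (g : C -> C) (F : set_system C) k : Filter F ->
  g x @[x --> F] --> b -> qpoch q (g x) k @[x --> F] --> qpoch q b k.
Proof.
move=> FF gb; elim: k => [|k IH].
  by rewrite qpoch0; under eq_fun do rewrite qpoch0; exact: cvg_cst.
rewrite qpochS; under eq_fun do rewrite qpochS.
by apply: cvgM => //; apply: cvgB; [exact: cvg_cst | apply: cvgMl].
Qed.

Lemma cvg_phi43_term n j k : phi43_term n j k b @[b --> a^'] --> phi43_term n j k a.
Proof.
have cid : b @[b --> a^'] --> a by exact: cvg_within.
have cqb : q / b @[b --> a^'] --> q / a by apply: cvgM; [exact: cvg_cst | exact: cvgV].
rewrite /phi43_term; apply: cvgMl; apply: cvgM; first by apply: cvgM; apply: cvg_qpoch.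
apply: cvgMl; elim: {j}k => [|k IH]; first by under eq_fun do rewrite expr0; exact: cvg_cst.
under eq_fun do rewrite exprS; rewrite exprS.
by apply: cvgM => //; exact: cvgN.
Qed.

(** The extension by continuity in a is the termwise cancelled form: only finitely
    many b are excluded in qpoch_phi43_rawE, so the two agree near a, and the
    cancelled form is continuous. *)
Lemma qpoch_phi43E n j : (j < n)%N ->
  qpoch_phi43 n.+1 q c j a = \sum_(k < j.+1) phi43_term n j k a.
Proof.
move=> jn; rewrite /qpoch_phi43; case: ifPn => [_ | /existsPn ha]; last first.
  apply: qpoch_phi43_rawE => //; first exact: ltnW.
  move=> s /andP[s0 sj]; have sn : (s < n)%N := leq_ltn_trans sj jn.
  by have := ha (Ordinal sn); rewrite /= s0.
apply: (@cvg_lim C); first exact: (@norm_hausdorff C C^o).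
have H : \sum_(k < j.+1) phi43_term n j k b @[b --> a^']
    --> \sum_(k < j.+1) phi43_term n j k a.
  apply: (@cvg_big C) => [z|k _].
    by apply: (@cvgD C C^o); [exact: cvg_fst | exact: cvg_snd].
  exact: cvg_phi43_term.
apply: cvg_trans H; apply: near_eq_cvg; near=> b; rewrite qpoch_phi43_rawE //.
- exact: ltnW.
- near: b; apply: (@cvgr_neq0 C C^o _ _ _ _ a) => //; exact: cvg_within.
- have hb : forall s : 'I_n, b != q ^+ s.
    near: b; apply: filter_forall => s; have [->|as_neq] := eqVneq a (q ^+ s).
      exact: nbhs_dnbhs_neq.
    have : \forall b \near a^', b - q ^+ s != 0.
      apply: (@cvgr_neq0 C C^o _ _ _ _ (a - q ^+ s)); last by rewrite subr_eq0.
      by apply: (@cvgB C C^o); [exact: cvg_within | exact: cvg_cst].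
    by apply: filterS => b; rewrite subr_eq0.
  by move=> s /andP[_ sj]; exact: (hb (Ordinal (leq_ltn_trans sj jn))).
Unshelve. all: by end_near. Qed.

Lemma fpolyE n k : (fpoly n.+1 q a c)`_k = if (k < n)%N then
  - ((qpoch q (q / c) n * qpoch q (c / q ^+ n.+1) n)
      / (qpoch q (a * q / c) n * qpoch q q n) * q ^+ n)
  * conv (fun i => (Ppoly n.+1 q a c)`_i) (phi_coef [tuple a; q] [tuple c / q ^+ n] q) k
  else 0.
Proof.
rewrite /fpoly /= expq_pred // coefZ coef_sum -exprnN.
set t := a * q ^+ n.+1 / c.
under eq_bigr => j _ do rewrite coefZ exprZn coefZ coefXn.
case: ltnP => kn; last first.
  rewrite big1 ?mulr0 // => j _.
  by rewrite gtn_eqF ?mulr0 // (leq_trans (ltn_ord j)).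
congr (_ * _); rewrite (bigD1 (Ordinal kn)) //= eqxx mulr1 [X in _ + X]big1 ?addr0; last first.
  by move=> i /negPf; rewrite -val_eqE /= eq_sym => ->; rewrite !mulr0.
rewrite qpoch_phi43E // convC /conv !mulr_suml; apply: eq_bigr => i _.
have ik : (i <= k)%N := leq_ord i.
rewrite PpolyE // phi_coef21 /phi43_term.
have qn0 := expf_neq0 n q0; have qk0 := expf_neq0 k q0.
have q2c0 : q ^+ 2 / c != 0 by rewrite mulf_neq0 ?invr_eq0 ?expf_neq0.
rewrite [qpoch q (q ^+ n)^-1 k](qpoch_take q0 _ ik) ?invr_eq0 //.
rewrite [qpoch q q k](qpoch_take q0 q0 ik).
rewrite [qpoch q (q ^+ 2 / c) k](qpoch_take q0 q2c0 ik).
have -> : q / ((q ^+ n)^-1 * q ^+ k) = q ^+ (n.+1 - k).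
  apply: (mulIf qk0); rewrite -exprD subnK ?(leqW (ltnW kn)) // exprS.
  by field; rewrite qn0 qk0.
have -> : q / (q * q ^+ k) = (q ^+ k)^-1 by field; rewrite q0 qk0.
have -> : q / (q ^+ 2 / c * q ^+ k) = c / q ^+ k.+1.
  by rewrite [q ^+ k.+1]exprS; field; rewrite q0 qk0 c0.
have -> : t ^+ k = t ^+ i * t ^+ (k - i) by rewrite -exprD subnKC.
have e : (- (q / a)) ^+ i * (- (q ^+ n)^-1) ^+ i * q ^+ i * t ^+ i
   = (- q) ^+ i * (- (q ^+ 2 / c)) ^+ i.
  rewrite -!exprMn; congr (_ ^+ _); rewrite /t exprS; field.
  by rewrite qn0 a0 c0.
have h1 : (- q) ^+ i != 0 by rewrite expf_neq0 // oppr_eq0.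
have h2 : (- (q ^+ 2 / c)) ^+ i != 0 by rewrite expf_neq0 // oppr_eq0.
have h3 : q ^+ ((k - i) * i + 'C(i, 2)) != 0 by rewrite expf_neq0.
have h4 := qpochq_neq0 q_not_root1 i.
have h5 := qpochq_neq0 q_not_root1 (k - i).
have h6 : qpoch q (c / q ^+ n) i != 0 by rewrite exprnN; apply: qpoch_int_neq0.
have h7 : qpoch q (q ^+ (n.+1 - k)) i != 0.
  by apply: qpoch_neq0 => s; rewrite subSn ?(ltnW kn) // -exprD addSn.
have h8 : qpoch q (q ^+ k)^-1 i != 0.
  rewrite prodf_seq_neq0; apply/allP => s _ /=; rewrite subr_eq0 eq_sym.
  have sk : (s < k)%N := leq_trans (ltn_ord s) ik.
  rewrite -(inj_eq (mulfI qk0)) mulrA mulfV // mul1r mulr1.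
  have -> : q ^+ k = q ^+ s * q ^+ (k - s) by rewrite -exprD subnKC // ltnW.
  rewrite -subr_eq0 -{1}[q ^+ s]mulr1 -mulrBr mulf_neq0 ?expf_neq0 //.
  by rewrite subr_eq0 eq_sym -[(k - s)%N]prednK ?subn_gt0.
have h9 : qpoch q (c / q ^+ k.+1) i != 0 by rewrite exprnN; apply: qpoch_int_neq0.
have h10 := qpoch_q2c_neq0 (k - i).
move: h1 h2 h3 h4 h5 h6 h7 h8 h9 h10 e.
set s1 := (- q) ^+ i; set s2 := (- (q ^+ 2 / c)) ^+ i; set s3 := q ^+ (_ + _)%N.
set s4 := qpoch q q i; set s5 := qpoch q q (k - i); set s6 := qpoch q (c / q ^+ n) i.
set s7 := qpoch q (q ^+ (n.+1 - k)) i; set s8 := qpoch q (q ^+ k)^-1 i.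
set s9 := qpoch q (c / q ^+ k.+1) i; set s10 := qpoch q (q ^+ 2 / c) (k - i).
set x1 := (- (q / a)) ^+ i; set x2 := (- (q ^+ n)^-1) ^+ i; set x3 := q ^+ i.
set x4 := t ^+ i; set y1 := qpoch q (q / a) _; set y2 := qpoch q a i.
set y3 := qpoch q (q ^+ n)^-1 _; set y4 := t ^+ _ => h1 h2 h3 h4 h5 h6 h7 h8 h9 h10 e.
rewrite [LHS](_ : _ = (x1 * x2 * x3 * x4) / (s1 * s2) * (y1 * y2 * y3 * y4 / (s5 * s6 * s10))).
  by rewrite e; field; rewrite h1 h2 h4 h5 h6 h10.
by field; rewrite h1 h2 h3 h5 h6 h7 h8 h9 h10.
Qed.

Definition contiguity_const (n : nat) : C :=
  (qpoch q (q / c) n * qpoch q (c / q ^+ n.+1) n)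
   / (qpoch q (a * q / c) n * qpoch q q n) * q ^+ n.

Lemma contiguity n N :
  conv (fun i => ('X^n : {poly C})`_i) (phi_coef [tuple a; q ^+ n.+1] [tuple c] q) N
  = (fpoly n.+1 q a c)`_N
    + contiguity_const n * conv (fun i => (Ppoly n.+1 q a c)`_i)
        (phi_coef [tuple a; q] [tuple c / q ^+ n] q) N.
Proof.
rewrite conv_Xn fpolyE // -/(contiguity_const n); case: leqP => nN; last first.
  by rewrite mulNr addrC subrr.
rewrite add0r -{2}(subnKC nN) contiguous_coef // /contiguity_const.
rewrite [qpoch q (q / c) n](qpoch_reflect q0); last by rewrite mulf_neq0 ?invr_eq0.
rewrite [qpoch q (a * q / c) n](qpoch_reflect q0); last by rewrite !mulf_neq0 ?invr_eq0.
have qn0 := expf_neq0 n q0.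
have -> : q / (q / c * q ^+ n) = c / q ^+ n by field; rewrite q0 c0 qn0.
have -> : q / (a * q / c * q ^+ n) = c / (a * q ^+ n) by field; rewrite q0 c0 a0 qn0.
have e : (- (q / c)) ^+ n * (a / q) ^+ n * q ^+ n = (- (a * q / c)) ^+ n.
  by rewrite -!exprMn; congr (_ ^+ _); field; rewrite q0 c0.
have h1 : qpoch q (c / q ^+ n) n != 0 by rewrite exprnN; apply: qpoch_int_neq0.
have h2 : qpoch q (c / q ^+ n.+1) n != 0 by rewrite exprnN; apply: qpoch_int_neq0.
have h3 := qpochq_neq0 q_not_root1 n.
have h4 : qpoch q (c / (a * q ^+ n)) n != 0.
  rewrite invfM mulrA exprnN; apply: qpoch_int_neq0 => // i.
  by apply: contra (hac (- i)) => /eqP e'; rewrite -invr_expz -e' invf_div.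
have h5 : q ^+ 'C(n, 2) != 0 by rewrite expf_neq0.
have h6 : (- (a * q / c)) ^+ n != 0.
  by rewrite expf_neq0 // oppr_eq0 !mulf_neq0 ?invr_eq0.
move: h6; rewrite -e; set x := (- (q / c)) ^+ n.
rewrite !mulf_eq0 !negb_or => /andP[/andP[h6 h7] h8].
by field; rewrite h1 h2 h3 h4 h5 h6 h7 h8.
Qed.

(** The relation contiguity multiplied by 1phi0(c/(a q^m); t x). The two Heine
    transformations have the same prefactor because a q^m / c = a q / (c q^(-n)). *)
Lemma contiguity_heine n N :
  let t := a * q ^+ n.+1 / c in
  conv (fun i => ('X^n : {poly C})`_i)
    (fun k => t ^+ k * phi_coef [tuple c / a; c / q ^+ n.+1] [tuple c] q k) N
  = conv (fun i => (fpoly n.+1 q a c)`_i)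
      (fun k => t ^+ k * phi_coef [tuple c / (a * q ^+ n.+1)] [tuple] q k) N
    + contiguity_const n * conv (fun i => (Ppoly n.+1 q a c)`_i)
      (fun k => t ^+ k
        * phi_coef [tuple c / (a * q ^+ n); c / q ^+ n.+1] [tuple c / q ^+ n] q k) N.
Proof.
move=> t; set b := fun k => t ^+ k * phi_coef [tuple c / (a * q ^+ n.+1)] [tuple] q k.
have qn0 := expf_neq0 n q0; have qn10 := expf_neq0 n.+1 q0.
have hcj j : c * q ^+ j != 1.
  by apply: contra (hc (- j%:Z)) => /eqP e; rewrite -exprnN -[_^-1]mul1r -e mulfK ?expf_neq0.
have hcnj j : c / q ^+ n * q ^+ j != 1.
  apply: contra (hc (n%:Z - j%:Z)) => /eqP e.
  rewrite expfzDr // -exprnP -exprnN -[_^-1]mul1r -e mulfK ?expf_neq0 //.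
  by rewrite mulrC divfK.
have e1 k : t ^+ k * phi_coef [tuple c / a; c / q ^+ n.+1] [tuple c] q k
    = conv b (phi_coef [tuple a; q ^+ n.+1] [tuple c] q) k.
  rewrite phi_coef21 -heine_coef //; apply: eq_conv => i _; last by rewrite phi_coef21.
  by rewrite /b phi_coef10.
have e2 k : t ^+ k * phi_coef [tuple c / (a * q ^+ n); c / q ^+ n.+1] [tuple c / q ^+ n] q k
    = conv b (phi_coef [tuple a; q] [tuple c / q ^+ n] q) k.
  have := @heine_coef _ q q_not_root1 a q (c / q ^+ n) k a0 q0 (mulf_neq0 c0 (invr_neq0 qn0)) hcnj.
  have -> : a * q / (c / q ^+ n) = t by rewrite /t exprS; field; rewrite c0 qn0.
  have -> : c / q ^+ n / (a * q) = c / (a * q ^+ n.+1).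
    by rewrite exprS; field; rewrite a0 q0 qn0.
  have -> : c / q ^+ n / a = c / (a * q ^+ n) by field; rewrite a0 qn0.
  have -> : c / q ^+ n / q = c / q ^+ n.+1 by rewrite exprS; field; rewrite q0 qn0.
  rewrite phi_coef21 => <-; apply: eq_conv => i _; last by rewrite phi_coef21.
  by rewrite /b phi_coef10.
rewrite (eq_conv (fun _ _ => erefl) (fun k _ => e1 k)) convA.
rewrite (eq_conv (fun k _ => convC _ _ k) (fun _ _ => erefl)) -convA.
rewrite (eq_conv (fun _ _ => erefl) (fun k _ => contiguity n k)) convDr convZr.
congr (_ + _ * _); first exact: convC.
rewrite convA (eq_conv (fun k _ => convC _ _ k) (fun _ _ => erefl)) -convA.
by apply: eq_conv => // k _; rewrite e2.
Qed.
End Contiguity.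

(** * Convergence of sequences with geometrically small steps *)

(** A consequence of completeness that makes sense over any numFieldType, where
    norms take values in the field itself. *)
Definition geometrically_complete (C : numFieldType) : Prop :=
  forall (u : nat -> C) (M r : C), 0 <= r < 1 ->
  (forall n, `|u n.+1 - u n| <= M * r ^+ n) -> cvgn u.

Lemma real_geometrically_complete (R : realType) : geometrically_complete R.
Proof.
move=> u M r /andP[r0 r1] hu.
have M0 : 0 <= M by have := le_trans (normr_ge0 _) (hu 0); rewrite mulr1.
have -> : u = (fun n => u 0%N + series (fun k => u k.+1 - u k) n).
  by apply/funext => n; rewrite /series /= telescope_sumr // addrC subrK.
apply: is_cvgD; first exact: is_cvg_cst.
apply: normed_cvg; apply: (@series_le_cvg _ _ (geometric M r)) => //.
- by move=> n; exact: normr_ge0.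
- by move=> n; rewrite /geometric /= mulr_ge0 ?exprn_ge0.
- by apply: is_cvg_geometric_series; rewrite ger0_norm.
Qed.

Lemma dist_le_is_cvg (C : numFieldType) (u : nat -> C) (l : C) :
  (forall e, 0 < e -> \forall n \near \oo, `|l - u n| <= e) -> cvgn u.
Proof.
move=> h; have H : u @ \oo --> l by apply/(@cvgrPdist_le C C^o).
exact: cvgP H.
Qed.

Section Complex.
Local Open Scope complex_scope.

Lemma norm_Re_Im (R : realType) (z : R[i]) (x : R) : `|z| <= x%:C ->
  `|complex.Re z| <= x /\ `|complex.Im z| <= x.
Proof.
rewrite normc_def lecR => zx; split; apply: le_trans zx.
- by rewrite -sqrtr_sqr ler_wsqrtr // lerDl sqr_ge0.
- by rewrite -sqrtr_sqr ler_wsqrtr // lerDr sqr_ge0.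
Qed.

Lemma complex_geometrically_complete (R : realType) : geometrically_complete R[i].
Proof.
move=> u M r /andP[r0 r1] hu.
have M0 : 0 <= M by have := le_trans (normr_ge0 _) (hu 0); rewrite mulr1.
have [Mr rr] : (complex.Re M)%:C = M /\ (complex.Re r)%:C = r.
  by split; apply: RRe_real; apply: ger0_real.
have hr : 0 <= complex.Re r < 1 by rewrite -lecR -ltcR rr r0.
have hRI n : `|complex.Re (u n.+1 - u n)| <= complex.Re M * complex.Re r ^+ n /\
    `|complex.Im (u n.+1 - u n)| <= complex.Re M * complex.Re r ^+ n.
  by apply: norm_Re_Im; rewrite rmorphM rmorphXn /= Mr rr.
have /cvg_ex[/= x ux] : cvgn (fun n => complex.Re (u n)).
  apply: (real_geometrically_complete hr) => n; have [+ _] := hRI n.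
  by rewrite !raddfB; apply.
have /cvg_ex[/= y uy] : cvgn (fun n => complex.Im (u n)).
  apply: (real_geometrically_complete hr) => n; have [_] := hRI n.
  by rewrite !raddfB; apply.
apply: (@dist_le_is_cvg _ u (x +i* y)) => e e0.
have er : (complex.Re e)%:C = e by apply: RRe_real; apply: gtr0_real.
have e20 : 0 < complex.Re e / 2 by rewrite divr_gt0 // -ltcR er.
near=> n; rewrite -er [complex.Re e]splitr.
have -> : x +i* y - u n = (x - complex.Re (u n))%:C + 'i * (y - complex.Im (u n))%:C.
  by rewrite [LHS]complexE !raddfB.
have normC (z : R) : `|z%:C| = `|z|%:C.
  by rewrite normc_def /= expr0n /= addr0 sqrtr_sqr.
apply: (le_trans (ler_normD _ _)); rewrite normrM !normC rmorphD /=.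
have -> : `|'i : R[i]| = 1 by rewrite normc_def /= expr0n expr1n add0r sqrtr1.
rewrite mul1r lerD // lecR.
- by near: n; apply: (@cvgr_dist_le R R^o).
- by near: n; apply: (@cvgr_dist_le R R^o).
Unshelve. all: by end_near. Qed.

End Complex.

(** * Bounds for shifted factorials *)

Definition bounded_seq (C : numFieldType) (u : nat -> C) : Prop :=
  exists M, forall n, `|u n| <= M.

Lemma bounded_seqM (C : numFieldType) (u v : nat -> C) :
  bounded_seq u -> bounded_seq v -> bounded_seq (fun n => u n * v n).
Proof. by move=> [M hM] [N hN]; exists (M * N) => n; rewrite normrM ler_pM. Qed.

Lemma bounded_seq_shift (C : numFieldType) N (u : nat -> C) :
  bounded_seq (fun n => u (N + n)%N) -> bounded_seq u.
Proof.
move=> [M hM]; have M0 : 0 <= M := le_trans (normr_ge0 _) (hM 0%N).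
exists (M + \sum_(i < N) `|u i|) => n; case: (ltnP n N) => nN.
  rewrite (bigD1 (Ordinal nN)) //= addrCA lerDl addr_ge0 //; exact: sumr_ge0.
by rewrite -(subnKC nN) ler_wpDr // sumr_ge0.
Qed.

Lemma cvg_bounded0 (C : numFieldType) (u v : nat -> C) :
  bounded_seq u -> v @ \oo --> 0 -> (fun n => u n * v n) @ \oo --> 0.
Proof.
move=> [M hM] v0; have M0 : 0 <= M := le_trans (normr_ge0 _) (hM 0%N).
apply/(@cvgr0Pnorm_le C C^o) => e e0.
have e'0 : 0 < e / (M + 1) by rewrite divr_gt0 // ltr_wpDl.
near=> n; have hn : `|v n| <= e / (M + 1).
  by near: n; exact: (@cvgr0_norm_le C C^o).
rewrite normrM (le_trans (ler_pM _ _ (hM n) hn)) //.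
rewrite mulrCA ler_piMr ?(ltW e0) // ler_pdivrMr ?ltr_wpDl //.
by rewrite mul1r lerDl.
Unshelve. all: by end_near. Qed.

(** The limit l exists by completeness and satisfies l = y l. *)
Lemma cvg_expr0 (C : numFieldType) (y : C) :
  geometrically_complete C -> `|y| < 1 -> (fun n => y ^+ n) @ \oo --> 0.
Proof.
move=> hC y1; have : cvgn (fun n => y ^+ n).
  apply: (hC _ `|y - 1| `|y|) => [|n]; first by rewrite normr_ge0.
  by rewrite exprS -{2}[y ^+ n]mul1r -mulrBl normrM normrX.
move=> /cvg_ex[/= l yl]; suff <- : l = 0 by [].
have y1l : (fun n => y ^+ n.+1) @ \oo --> l.
  by rewrite (cvg_shiftS (fun n => y ^+ n)).
have y1yl : (fun n => y ^+ n.+1) @ \oo --> y * l.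
  by under eq_fun do rewrite exprS; exact: cvgMl_tmp.
have e : l = y * l := cvg_unique (@norm_hausdorff C C^o) y1l y1yl.
apply/eqP; have : l * (1 - y) == 0 by rewrite mulrBr mulr1 [l * y]mulrC -e subrr.
rewrite mulf_eq0 => /orP[//|]; rewrite subr_eq0 => /eqP y_1.
by move: y1; rewrite -y_1 normr1 ltxx.
Qed.

(** The Weierstrass product inequality: the product of the 1 - x r^j is at least 1
    minus the sum of the x r^j. *)
Lemma weierstrass_prod_ge (C : numFieldType) (x r : C) n :
  0 <= x -> 0 <= r < 1 -> x <= (1 - r) / 2 -> 2^-1 <= qpoch r x n.
Proof.
move=> x0 /andP[r0 r1] xr; have r10 : 0 < 1 - r by rewrite subr_gt0.
have half : 1 - 2^-1 = 2^-1 :> C by field.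
have h20 : 0 <= 2^-1 :> C by rewrite invr_ge0 ler0n.
have x1 : x <= 1.
  apply: (le_trans xr); rewrite mulr_ile1 ?(ltW r10) //; first by rewrite gerBl.
  by rewrite invf_le1 ?ltr0n // ler1n.
have S : x * (\sum_(j < n) r ^+ j) <= 2^-1.
  apply: (@le_trans _ _ ((1 - r) / 2 * \sum_(j < n) r ^+ j)).
    by rewrite ler_wpM2r // sumr_ge0 // => j _; rewrite exprn_ge0.
  rewrite mulrAC -[1 - r]opprB mulNr -subrX1 opprB ler_piMl // gerBl.
  by rewrite exprn_ge0.
suff : 1 - x * (\sum_(j < n) r ^+ j) <= qpoch r x n.
  by apply: le_trans; rewrite -{1}half lerD2l lerN2.
elim: n {S} => [|n IH]; first by rewrite big_ord0 qpoch0 mulr0 subr0.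
rewrite qpochS big_ord_recr /=.
have h : 0 <= 1 - x * r ^+ n.
  by rewrite subr_ge0 mulr_ile1 ?exprn_ge0 ?exprn_ile1 // (ltW r1).
apply: (le_trans _ (ler_wpM2r h IH)).
rewrite [leRHS](_ : _ = 1 - x * (\sum_(j < n) r ^+ j + r ^+ n)
   + x * (\sum_(j < n) r ^+ j) * (x * r ^+ n)); last by ring.
rewrite lerDl !mulr_ge0 ?exprn_ge0 // sumr_ge0 // => j _.
by rewrite exprn_ge0.
Qed.

(** The upper bound on |(a; q)_n| is stated as a product because it comes from
    (1 + x)(1 - x) <= 1; so one lower bound for (|a|; |q|)_n serves twice. *)
Lemma norm_qpoch_ge (C : numFieldType) (q a : C) n : `|a| <= 1 -> `|q| <= 1 ->
  qpoch `|q| `|a| n <= `|qpoch q a n| /\ `|qpoch q a n| * qpoch `|q| `|a| n <= 1.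
Proof.
move=> a1 q1; elim: n => [|n [IH1 IH2]]; first by rewrite !qpoch0 normr1 mulr1.
rewrite !qpochS normrM; set x := `|a| * `|q| ^+ n.
have x0 : 0 <= x by rewrite mulr_ge0 ?exprn_ge0.
have x1 : x <= 1 by rewrite mulr_ile1 ?exprn_ge0 ?exprn_ile1.
have nx : `|a * q ^+ n| = x by rewrite normrM normrX.
have p0 : 0 <= qpoch `|q| `|a| n.
  apply: prodr_ge0 => i _; rewrite subr_ge0 mulr_ile1 ?exprn_ge0 ?exprn_ile1 //.
have lo : 1 - x <= `|1 - a * q ^+ n|.
  by rewrite -nx -{1}(normr1 C) lerB_dist.
have hi : `|1 - a * q ^+ n| <= 1 + x by rewrite -nx -{2}(normr1 C) ler_normB.
have x10 : 0 <= 1 - x by rewrite subr_ge0.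
split; first by rewrite ler_pM.
rewrite mulrACA -[leRHS]mulr1 ler_pM ?mulr_ge0 //.
apply: (le_trans (ler_wpM2r x10 hi)).
have -> : (1 + x) * (1 - x) = 1 - x * x by ring.
by rewrite gerBl mulr_ge0.
Qed.

(** The first N factors contribute a constant, and |a q^N| is small enough for the
    Weierstrass inequality. A vanishing factor does no harm: 0^-1 = 0 is bounded. *)
Lemma bounded_qpoch (C : numFieldType) (q a : C) :
  geometrically_complete C -> `|q| < 1 ->
  bounded_seq (qpoch q a) /\ bounded_seq (fun n => (qpoch q a n)^-1).
Proof.
move=> hC q1.
have e0 : 0 < (1 - `|q|) / 2 by rewrite divr_gt0 ?ltr0n // subr_gt0.
have [N hN] : exists N, `|a * q ^+ N| <= (1 - `|q|) / 2.
  have H : (fun n => a * q ^+ n) @ \oo --> 0.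
    by rewrite -[0 in X in _ --> X](mulr0 a); apply: cvgMl_tmp; exact: cvg_expr0.
  have [N _ hN] := @cvgr0_norm_le C C^o _ _ _ _ H _ e0.
  by exists N; apply: hN => /=.
have a1 : `|a * q ^+ N| <= 1.
  apply: (le_trans hN); rewrite mulr_ile1 ?invr_ge0 ?ler0n ?subr_ge0 ?gerBl ?(ltW q1) //.
  by rewrite invf_le1 ?ltr0n // ler1n.
have W n : 2^-1 <= qpoch `|q| `|a * q ^+ N| n.
  by apply: weierstrass_prod_ge => //; rewrite normr_ge0 q1.
have h20 : 0 < 2^-1 :> C by rewrite invr_gt0 ltr0n.
split; apply: (@bounded_seq_shift _ N).
- exists (`|qpoch q a N| * 2) => n; rewrite qpochD normrM ler_wpM2l //.
  have [lo hi] := norm_qpoch_ge n a1 (ltW q1).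
  rewrite -(ler_pM2r h20) mulfV ?pnatr_eq0 //; apply: le_trans hi.
  by rewrite ler_wpM2l.
- exists (`|(qpoch q a N)^-1| * 2) => n; rewrite qpochD invfM normrM ler_wpM2l //.
  have [lo hi] := norm_qpoch_ge n a1 (ltW q1).
  have lo2 := le_trans (W n) lo.
  by rewrite normfV invf_ple ?posrE ?ltr0n // (lt_le_trans h20).
Qed.

(** * Evaluating formal relations by partial sums *)

Section NullSequences.
Variable C : numFieldType.
Implicit Types (u v : nat -> C).

Lemma cvg0D u v : u @ \oo --> 0 -> v @ \oo --> 0 -> (fun n => u n + v n) @ \oo --> 0.
Proof. by move=> hu hv; rewrite -[0 in X in _ --> X](addr0 0); exact: (@cvgD C C^o). Qed.

Lemma cvg0Z (k : C) u : u @ \oo --> 0 -> (fun n => k * u n) @ \oo --> 0.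
Proof. by move=> hu; rewrite -[0 in X in _ --> X](mulr0 k); exact: cvgMl_tmp. Qed.

Lemma cvg0Dl u v (l : C) : u @ \oo --> 0 -> v @ \oo --> l -> (fun n => u n + v n) @ \oo --> l.
Proof. by move=> hu hv; rewrite -(add0r l); exact: (@cvgD C C^o). Qed.

Lemma conv_polyMXaddC (p : {poly C}) (c : C) v n :
  conv (fun i => (p * 'X + c%:P)`_i) v n
  = (if n is n'.+1 then conv (fun i => p`_i) v n' else 0) + c * v n.
Proof.
have coefE i : (p * 'X + c%:P)`_i = if i is i'.+1 then p`_i' else c.
  by rewrite coefD coefMX coefC; case: i => [|i] /=; rewrite ?add0r ?addr0.
rewrite /conv big_ord_recl coefE subn0 addrC; congr (_ + _).
case: n => [|n]; first by rewrite big_ord0.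
by apply: eq_bigr => i _; rewrite lift0 coefE subSS.
Qed.

(** Multiplication by a polynomial commutes with taking partial sums up to boundary
    terms, which tend to 0 with the terms of v. *)
Lemma conv_poly_series (p : {poly C}) v (x : C) :
  (fun n => v n * x ^+ n) @ \oo --> 0 ->
  (fun n => conv (fun i => p`_i) v n * x ^+ n) @ \oo --> 0 /\
  (fun n => series (fun k => conv (fun i => p`_i) v k * x ^+ k) n
            - p.[x] * series (fun k => v k * x ^+ k) n) @ \oo --> 0.
Proof.
move=> v0; elim/poly_ind: p => [|p c [IH1 IH2]].
  have conv0 n : conv (fun i => (0 : {poly C})`_i) v n = 0.
    by rewrite /conv big1 // => i _; rewrite coef0 mul0r.
  split; [under eq_fun do rewrite conv0 mul0r | ]; first exact: cvg_cst.
  under eq_fun => n.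
    rewrite horner0 mul0r subr0 seriesEnat /= big1; last by move=> i _; rewrite conv0 mul0r.
    over.
  exact: cvg_cst.
set w := conv (fun i => p`_i) v.
have e : (fun n => conv (fun i => (p * 'X + c%:P)`_i) v n * x ^+ n)
   = (fun n => (if n is n'.+1 then w n' else 0) * x ^+ n + c * (v n * x ^+ n)).
  by apply/funext => n; rewrite conv_polyMXaddC mulrDl -mulrA.
rewrite e; split.
  apply: cvg0D; last exact: cvg0Z.
  rewrite -(@cvg_shiftS C); under eq_fun do rewrite exprS mulrCA.
  exact: cvg0Z.
have e2 n : series (fun k => (if k is k'.+1 then w k' else 0) * x ^+ k) n.+1
    = x * series (fun k => w k * x ^+ k) n.
  rewrite !seriesEnat /= big_nat_recl // mul0r add0r mulr_sumr.
  by apply: eq_bigr => i _; rewrite exprS mulrCA.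
rewrite -(@cvg_shiftS C) /=.
rewrite [X in X @ _](_ : _ = (fun n =>
    x * (series (fun k => w k * x ^+ k) n - p.[x] * series (fun k => v k * x ^+ k) n)
    + - (p.[x] * x) * (v n * x ^+ n))); last first.
  apply/funext => n; rewrite hornerMXaddC.
  rewrite [X in X - _](_ : _ = x * series (fun k => w k * x ^+ k) n
      + c * series (fun k => v k * x ^+ k) n.+1); last first.
    by rewrite -e2 !seriesEnat /= big_split mulr_sumr.
  by rewrite seriesSr; ring.
by apply: cvg0D; apply: cvg0Z.
Qed.

(** The formal relation x^n u = f b + k p s, read at a root x of p: the partial
    sums of p s are, up to a null sequence, p(x) = 0 times those of s. *)
Lemma root_evaluation n (f p : {poly C}) (k x beta : C) (u b s : nat -> C) :
  (forall N, conv (fun i => ('X^n : {poly C})`_i) u N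
     = conv (fun i => f`_i) b N + k * conv (fun i => p`_i) s N) ->
  (fun N => u N * x ^+ N) @ \oo --> 0 ->
  (fun N => b N * x ^+ N) @ \oo --> 0 ->
  (fun N => s N * x ^+ N) @ \oo --> 0 ->
  root p x -> x != 0 ->
  series (fun N => b N * x ^+ N) @ \oo --> beta ->
  series (fun N => u N * x ^+ N) @ \oo --> x ^- n * f.[x] * beta.
Proof.
move=> H u0 b0 s0 /rootP px x0 hb.
have [_ hu] := @conv_poly_series 'X^n _ _ u0.
have [_ hf] := @conv_poly_series f _ _ b0.
have [_ hs] := @conv_poly_series p _ _ s0.
move: hu hf hs; rewrite px hornerXn.
set U := series (fun N => u N * _); set B := series (fun N => b N * _).
set S := series (fun N => s N * _).
set U' := series _; set B' := series _; set S' := series _ => hu hf hs.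
have e L : U' L = B' L + k * S' L.
  rewrite /U' /B' /S' !seriesEnat /= mulr_sumr -big_split; apply: eq_bigr => i _ /=.
  by rewrite H mulrDl mulrA.
have -> : U = (fun L => x ^- n * ((- 1) * (U' L - x ^+ n * U L) + (B' L - f.[x] * B L)
     + k * (S' L - 0 * S L)) + x ^- n * f.[x] * B L).
  apply/funext => L; rewrite e; field.
  by rewrite expf_neq0.
apply: cvg0Dl; last exact: cvgMl_tmp.
apply: cvg0Z; apply: cvg0D; last exact: cvg0Z.
by apply: cvg0D => //; exact: cvg0Z.
Qed.

End NullSequences.

(** * Infinite products and the q-binomial theorem *)

Section InfiniteProducts.
Variables (C : numFieldType) (q : C).
Hypotheses (hC : geometrically_complete C) (q1 : `|q| < 1).

Lemma cvg_qpoch_oo (a : C) : qpoch q a @ \oo --> qpoch_oo q a.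
Proof.
have [M hM] := (bounded_qpoch a hC q1).1.
apply: (hC (M := M * `|a|) (r := `|q|)); first by rewrite normr_ge0.
move=> n; rewrite qpochS mulrBr mulr1 addrC addKr normrN !normrM normrX mulrA.
by rewrite ler_wpM2r ?exprn_ge0 // ler_wpM2r.
Qed.

(** A zero limit would contradict the boundedness of the inverses. *)
Lemma qpoch_oo_neq0 (a : C) : (forall j, a * q ^+ j != 1) -> qpoch_oo q a != 0.
Proof.
move=> ha; apply/eqP => a_oo0; have H := @cvg_qpoch_oo a.
rewrite a_oo0 in H.
have := cvg_bounded0 (bounded_qpoch a hC q1).2 H.
under eq_fun do rewrite mulVf ?qpoch_neq0 //.
have H1 : (fun=> 1 : C) @ \oo --> (1 : C) by exact: cvg_cst.
move=> H0; have e01 : 0 = 1 :> C := cvg_unique (@norm_hausdorff C C^o) H0 H1.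
by have := oner_neq0 C; rewrite -e01 eqxx.
Qed.

Hypothesis q_not_root1 : forall n, q ^+ n.+1 != 1.

Lemma sum_expr_le (r : C) n : 0 <= r < 1 -> \sum_(i < n) r ^+ i <= (1 - r)^-1.
Proof.
move=> /andP[r0 r1]; have r10 : 0 < 1 - r by rewrite subr_gt0.
rewrite -[_^-1]mul1r ler_pdivlMr // mulrC -opprB mulNr -subrX1 opprB.
by rewrite gerBl exprn_ge0.
Qed.

Lemma lt1_qpoch_neq0 (y : C) n : `|y| < 1 -> qpoch q y n != 0.
Proof.
move=> y1; apply: qpoch_neq0 => j; apply/eqP => e.
have e1 : `|y| * `|q| ^+ j = 1 by rewrite -normrX -normrM e normr1.
have : `|y| * `|q| ^+ j < 1.
  by apply: le_lt_trans y1; rewrite ler_piMr // exprn_ile1 // ltW.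
by rewrite e1 ltxx.
Qed.

Lemma bounded_phi_coef10 (A : C) : bounded_seq (phi_coef [tuple A] [tuple] q).
Proof.
have [M hM] := bounded_seqM (bounded_qpoch A hC q1).1 (bounded_qpoch q hC q1).2.
by exists M => n; rewrite phi_coef10.
Qed.

(** The partial sums g_N satisfy (1 - z) g_N(z) = (1 - A z) g_N(q z) up to a
    boundary term in z^N. Iterating N times leads from g_N(y) to g_N(q^N y),
    which tends to 1, so that taking as many iterations as terms avoids any
    exchange of limits. *)
Lemma q_binomial (A y : C) : `|y| < 1 ->
  series (fun n => phi_coef [tuple A] [tuple] q n * y ^+ n) @ \oo
    --> qpoch_oo q (A * y) / qpoch_oo q y.
Proof.
move=> y1; set c := phi_coef [tuple A] [tuple] q.
have cS n : (1 - q ^+ n.+1) * c n.+1 = (1 - A * q ^+ n) * c n.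
  rewrite /c !phi_coef10 !qpochS -exprS; have := qpochq_neq0 q_not_root1 n.
  have : 1 - q ^+ n.+1 != 0 by rewrite subr_eq0 eq_sym.
  by move=> h1 h2; field; rewrite h1 h2.
have c00 : c 0%N = 1 by rewrite /c phi_coef10 !qpoch0 invr1 mulr1.
have [Mc hc] : bounded_seq c := bounded_phi_coef10 A.
clearbody c; pose g N z := series (fun n => c n * z ^+ n) N.
have g_step N z : (1 - z) * g N z = (1 - A * z) * g N (q * z) - (1 - q ^+ N) * c N * z ^+ N.
  rewrite /g; elim: N => [|N IH].
    by rewrite !seriesEnat /= !big_geq // !mulr0 !expr0 subrr !mul0r subrr.
  rewrite !seriesSr !mulrDr IH cS exprMn exprS; ring.
have nz k : 1 - y * q ^+ k != 0.
  have := lt1_qpoch_neq0 k.+1 y1; rewrite qpochS mulf_eq0 negb_or.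
  by move=> /andP[_].
have g_iter N k : g N y = qpoch q (A * y) k / qpoch q y k * g N (q ^+ k * y)
   - \sum_(i < k) qpoch q (A * y) i / qpoch q y i.+1 * ((1 - q ^+ N) * c N * (q ^+ i * y) ^+ N).
  elim: k => [|k IH].
    by rewrite !qpoch0 expr0 !mul1r invr1 mul1r big_ord0 subr0.
  rewrite IH big_ord_recr /= opprD addrA [RHS]addrAC; congr (_ + _).
  have yk := lt1_qpoch_neq0 k y1.
  have := g_step N (q ^+ k * y); rewrite [q * (_ * _)]mulrA -exprS => e.
  have -> : g N (q ^+ k * y) = ((1 - A * (q ^+ k * y)) * g N (q ^+ k.+1 * y)
      - (1 - q ^+ N) * c N * (q ^+ k * y) ^+ N) / (1 - y * q ^+ k).
    by rewrite -e [q ^+ k * y]mulrC mulrAC mulfV ?mul1r.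
  rewrite !qpochS; field; by rewrite yk nz.
have Mc0 : 0 <= Mc := le_trans (normr_ge0 _) (hc 0%N).
have q01 : 0 <= `|q| < 1 by rewrite normr_ge0.
have y01 : 0 <= `|y| < 1 by rewrite normr_ge0.
(* The boundary terms add up to a bounded multiple of y^N: for N >= 1 the factors
   q^(iN) are dominated by |q|^i, which is summable. *)
have rem : (fun N => \sum_(i < N) qpoch q (A * y) i / qpoch q y i.+1
    * ((1 - q ^+ N) * c N * (q ^+ i * y) ^+ N)) @ \oo --> 0.
  have [M1 h1] := (bounded_qpoch (A * y) hC q1).1.
  have [M2 h2] := (bounded_qpoch y hC q1).2.
  have M10 : 0 <= M1 := le_trans (normr_ge0 _) (h1 0%N).
  have M20 : 0 <= M2 := le_trans (normr_ge0 _) (h2 0%N).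
  rewrite [X in X @ _](_ : _ = (fun N => (\sum_(i < N) qpoch q (A * y) i / qpoch q y i.+1
    * ((1 - q ^+ N) * c N * q ^+ i ^+ N)) * y ^+ N)); last first.
    by apply/funext => N; rewrite mulr_suml; apply: eq_bigr => i _; rewrite exprMn !mulrA.
  apply: cvg_bounded0; last exact: cvg_expr0.
  exists (M1 * M2 * (2 * Mc) * (1 - `|q|)^-1) => -[|N].
    by rewrite big_ord0 normr0 !mulr_ge0 ?ler0n // invr_ge0 subr_ge0 ltW.
  apply: (le_trans (ler_norm_sum _ _ _)).
  apply: (@le_trans _ _ (\sum_(i < N.+1) M1 * M2 * (2 * Mc) * `|q| ^+ i)).
    apply: ler_sum => i _; rewrite !normrM -mulrA -!mulrA ler_pM ?mulr_ge0 //.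
    rewrite ler_pM ?mulr_ge0 // ler_pM ?mulr_ge0 //.
      apply: (le_trans (ler_normB _ _)); rewrite normr1 [2](_ : _ = 1 + 1) // lerD2l.
      by rewrite normrX exprn_ile1 // ltW.
    rewrite ler_pM // -exprM normrX mulnS exprD ler_piMr ?exprn_ge0 //.
    by rewrite exprn_ile1 // ltW.
  rewrite -mulr_sumr ler_wpM2l ?mulr_ge0 ?ler0n //.
  exact: sum_expr_le.
(* All terms of g_N(q^N y) but the first contain the factor q^N. *)
have head : (fun N => g N (q ^+ N * y)) @ \oo --> (1 : C).
  rewrite -(@cvg_shiftS C) /=.
  rewrite [X in X @ _](_ : _ = (fun N =>
     (\sum_(i < N) c i.+1 * y ^+ i.+1 * q ^+ N.+1 ^+ i) * q ^+ N.+1 + 1)); last first.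
    apply/funext => N; rewrite /g seriesEnat /= big_nat_recl // expr0 mulr1 addrC.
    congr (_ + _) => //.
    rewrite big_mkord mulr_suml; apply: eq_bigr => i _.
    by rewrite exprMn [q ^+ N.+1 ^+ i.+1]exprS; ring.
  set h := (X in (fun N => X N * _ + 1)).
  suff h0 : (fun N => h N * q ^+ N.+1) @ \oo --> 0.
    by apply: cvg0Dl => //; exact: cvg_cst.
  apply: cvg_bounded0; last by rewrite (cvg_shiftS (fun n => q ^+ n)); exact: cvg_expr0.
  exists (Mc * (1 - `|y|)^-1) => N.
  apply: (le_trans (ler_norm_sum _ _ _)).
  apply: (@le_trans _ _ (\sum_(i < N) Mc * `|y| ^+ i)).
    apply: ler_sum => i _; rewrite !normrM -mulrA ler_pM ?mulr_ge0 //.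
    rewrite !normrX exprS -mulrA mulrCA ler_piMr ?exprn_ge0 // mulr_ile1 ?exprn_ge0 ?(ltW y1) //.
    by rewrite !exprn_ile1 ?exprn_ge0 // ltW.
  by rewrite -mulr_sumr ler_wpM2l // sum_expr_le.
have -> : series (fun n => c n * y ^+ n) = (fun N =>
    qpoch q (A * y) N / qpoch q y N * g N (q ^+ N * y)
    - \sum_(i < N) qpoch q (A * y) i / qpoch q y i.+1
       * ((1 - q ^+ N) * c N * (q ^+ i * y) ^+ N)).
  by apply/funext => N; exact: g_iter.
rewrite -(subr0 (_ / _)); apply: (@cvgB C C^o) => //.
rewrite -[_ / _ in X in _ --> X]mulr1; apply: cvgM => //.
apply: cvgM; first exact: cvg_qpoch_oo.
apply: cvgV; last exact: cvg_qpoch_oo.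
apply: qpoch_oo_neq0 => j; have := nz j.
by rewrite subr_eq0 eq_sym.
Qed.

End InfiniteProducts.

(** * The evaluations *)

Section Evaluation.
Variables (C : numFieldType) (q a c : C).
Hypotheses (hC : geometrically_complete C) (hq : 0 < `|q| < 1).
Hypotheses (c0 : c != 0) (hc : forall i : int, c != q ^ i)
  (a0 : a != 0) (hac : forall i : int, a / c != q ^ i).

Let q1 : `|q| < 1. Proof. by case/andP: hq. Qed.
Let q0 : q != 0. Proof. by rewrite -normr_gt0; case/andP: hq. Qed.

Let q_not_root1 n : q ^+ n.+1 != 1.
Proof.
apply/eqP => e; have := normr1 C; rewrite -{1}e normrX => e1.
have : `|q| ^+ n.+1 < 1 by rewrite exprn_ilt1.
by rewrite e1 ltxx.
Qed.

Lemma bounded_phi_coef21 (x y z : C) : bounded_seq (phi_coef [tuple x; y] [tuple z] q).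
Proof.
have [M hM] := bounded_seqM
  (bounded_seqM (bounded_qpoch x hC q1).1 (bounded_qpoch y hC q1).1)
  (bounded_seqM (bounded_qpoch q hC q1).2 (bounded_qpoch z hC q1).2).
by exists M => n; rewrite phi_coef21 invfM.
Qed.

Lemma phi_terms0 (r : nat) (us : r.+1.-tuple C) (ls : r.-tuple C) x :
  phi_converges us ls q x -> (fun k => phi_coef us ls q k * x ^+ k) @ \oo --> 0.
Proof. exact: (@cvg_series_cvg_0 C C^o). Qed.

Lemma Ppoly_root_neq0 n x : root (Ppoly n.+1 q a c) x -> x != 0.
Proof.
move=> /rootP px; apply: contra_eq_neq px => ->.
by rewrite horner_coef0 PpolyE // !qpoch0 expr0 !mul1r !invr1 mulr1 oner_eq0.
Qed.

Lemma phi21_at_root n x : root (Ppoly n.+1 q a c) x ->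
  phi_converges [tuple a; q ^+ n.+1] [tuple c] q x ->
  phi [tuple a; q ^+ n.+1] [tuple c] q x
  = x ^ (1 - n.+1%:Z) * (fpoly n.+1 q a c).[x].
Proof.
move=> px cvx; have x0 := Ppoly_root_neq0 px; have u0 := phi_terms0 cvx.
(* The series 1, so that f itself is the product of f with a series. *)
pose delta k : C := (k == 0%N)%:R.
have conv_delta (u : nat -> C) N : conv u delta N = u N.
  rewrite /conv big_ord_recr /= subnn mulr1 big1 ?add0r // => i _.
  by rewrite /delta subn_eq0 leqNgt ltn_ord mulr0.
(* M is compared with F: the quotient of their coefficients is bounded. *)
have s0 : (fun k => phi_coef [tuple a; q] [tuple c / q ^+ n] q k * x ^+ k) @ \oo --> 0.
  have hb := bounded_seqM
    (bounded_seqM (bounded_qpoch q hC q1).1 (bounded_qpoch c hC q1).1)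
    (bounded_seqM (bounded_qpoch (c / q ^+ n) hC q1).2 (bounded_qpoch (q ^+ n.+1) hC q1).2).
  have := cvg_bounded0 hb u0; apply: cvg_trans; apply: near_eq_cvg; near=> k.
  rewrite !phi_coef21.
  have h1 := qpochq_neq0 q_not_root1 k.
  have h2 : qpoch q c k != 0 by exact: qpoch_nonpower_neq0.
  have h3 : qpoch q (c / q ^+ n) k != 0 by rewrite exprnN; apply: qpoch_int_neq0.
  have h4 : qpoch q (q ^+ n.+1) k != 0.
    by apply: qpoch_neq0 => j; rewrite -exprD addSn.
  by field; rewrite h1 h2 h3 h4.
have d0 : (fun k => delta k * x ^+ k) @ \oo --> 0.
  rewrite -(@cvg_shiftS C) /=; under eq_fun do rewrite /delta mul0r.
  exact: cvg_cst.
have d1 : series (fun k => delta k * x ^+ k) @ \oo --> (1 : C).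
  rewrite -(@cvg_shiftS C) /=; under eq_fun => k.
    rewrite seriesEnat /= big_nat_recl // expr0 mulr1 big1 ?addr0; last first.
      by move=> i _; rewrite /delta mul0r.
    over.
  exact: cvg_cst.
have H N : conv (fun i => ('X^n : {poly C})`_i) (phi_coef [tuple a; q ^+ n.+1] [tuple c] q) N
    = conv (fun i => (fpoly n.+1 q a c)`_i) delta N
      + contiguity_const q a c n * conv (fun i => (Ppoly n.+1 q a c)`_i)
        (phi_coef [tuple a; q] [tuple c / q ^+ n] q) N.
  by rewrite conv_delta contiguity.
have := root_evaluation H u0 d0 s0 px x0 d1.
rewrite mulr1 expq_pred => // /(@cvg_lim C _); apply.
exact: (@norm_hausdorff C C^o).
Unshelve. all: by end_near. Qed.

Lemma phi21_heine_at_root n x : root (Ppoly n.+1 q a c) x ->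
  phi_converges [tuple c / a; c / q ^+ n.+1] [tuple c] q (a * q ^+ n.+1 * x / c) ->
  phi [tuple c / a; c / q ^+ n.+1] [tuple c] q (a * q ^+ n.+1 * x / c)
  = qpoch_oo q x / qpoch_oo q (a * q ^+ n.+1 * x / c)
    * x ^ (1 - n.+1%:Z) * (fpoly n.+1 q a c).[x].
Proof.
set y := a * q ^+ n.+1 * x / c; move=> px cvy.
have x0 := Ppoly_root_neq0 px; have u0 := phi_terms0 cvy.
have hca i : c / a != q ^ i.
  by apply: contra (hac (- i)) => /eqP e; rewrite -invr_expz -e invf_div.
(* The coefficients are bounded away from 0, so y^k tends to 0. *)
have y1 : `|y| < 1.
  have hb := bounded_seqM
    (bounded_seqM (bounded_qpoch q hC q1).1 (bounded_qpoch c hC q1).1)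
    (bounded_seqM (bounded_qpoch (c / a) hC q1).2 (bounded_qpoch (c / q ^+ n.+1) hC q1).2).
  have yk0 : (fun k => y ^+ k) @ \oo --> 0.
    have := cvg_bounded0 hb u0; apply: cvg_trans; apply: near_eq_cvg; near=> k.
    rewrite phi_coef21.
    have h1 := qpochq_neq0 q_not_root1 k.
    have h2 : qpoch q c k != 0 by exact: qpoch_nonpower_neq0.
    have h3 : qpoch q (c / q ^+ n.+1) k != 0 by rewrite exprnN; apply: qpoch_int_neq0.
    have h4 : qpoch q (c / a) k != 0 by exact: qpoch_nonpower_neq0.
    by field; rewrite h1 h2 h3 h4.
  have [N _ hN] := @cvgr0_norm_lt C C^o _ _ _ _ yk0 _ (@ltr01 C).
  have := hN N (leqnn N) => /=; rewrite normrX => yN.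
  rewrite real_ltNge ?normr_real ?real1 //; apply/negP => y1.
  by have := lt_le_trans yN (exprn_ege1 N y1); rewrite ltxx.
have terms0 (u : nat -> C) : bounded_seq u ->
    (fun k => (a * q ^+ n.+1 / c) ^+ k * u k * x ^+ k) @ \oo --> 0.
  move=> hu; have := cvg_bounded0 hu (cvg_expr0 hC y1).
  apply: cvg_trans; apply: near_eq_cvg; near=> k.
  by rewrite [_ ^+ k * u k]mulrC -[u k * _ * _]mulrA -exprMn [_ / c * x]mulrAC.
have series_y (u : nat -> C) : series (fun k => u k * y ^+ k)
    = series (fun k => (a * q ^+ n.+1 / c) ^+ k * u k * x ^+ k).
  congr series; apply/funext => k.
  by rewrite [_ ^+ k * u k]mulrC -[u k * _ * _]mulrA -exprMn [_ / c * x]mulrAC.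
have B := @q_binomial _ _ hC q1 q_not_root1 (c / (a * q ^+ n.+1)) _ y1.
rewrite series_y in B.
have := root_evaluation (contiguity_heine q0 q_not_root1 a0 c0 hc hac n)
  (terms0 _ (bounded_phi_coef21 _ _ _)) (terms0 _ (bounded_phi_coef10 hC q1 _))
  (terms0 _ (bounded_phi_coef21 _ _ _)) px x0 B.
rewrite -series_y => /(@cvg_lim C _); rewrite /phi /phi_partial => ->; last first.
  exact: (@norm_hausdorff C C^o).
have -> : c / (a * q ^+ n.+1) * y = x.
  by rewrite /y; field; rewrite a0 c0 expf_neq0.
rewrite expq_pred //; ring.
Unshelve. all: by end_near. Qed.

Lemma root_Ppoly2 x : a != q ->
  root (Ppoly 2 q a c) x <-> x = (q ^+ 2 - c) / ((q - a) * q).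
Proof.
move=> aq; have qa : q - a != 0 by rewrite subr_eq0 eq_sym.
have qc : q ^+ 2 - c != 0 by rewrite subr_eq0 eq_sym (hc 2).
have q10 : 1 - q != 0 by rewrite subr_eq0 eq_sym (q_not_root1 0).
have -> : Ppoly 2 q a c = (- ((q - a) * q / (q ^+ 2 - c))) *: 'X + 1%:P.
  apply/polyP => -[|[|j]]; rewrite PpolyE // coefD coefZ coefX coefC /=.
  - by rewrite !qpoch0 expr0 !(mul1r, mulr1) invr1 mulr0 add0r.
  - rewrite !qpochS !qpoch0 !expr0 expr1 !mul1r !mulr1 addr0.
    by field; rewrite a0 c0 q0 q10 qc -opprB oppr_eq0 qc.
  - by rewrite (@qpoch_terminates _ q q0 1) // !(mulr0, mul0r) addr0.
have t0 : (q - a) * q / (q ^+ 2 - c) != 0 by rewrite !mulf_neq0 ?invr_eq0.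
rewrite rootE hornerD hornerZ hornerX hornerC addrC mulNr subr_eq0; split.
  by move=> /eqP e; rewrite -(mulKf t0 x) -e mulr1 invf_div.
by move=> ->; rewrite -[X in _ * X]invf_div mulfV.
Qed.

Lemma horner_fpoly2 x : a != q -> let lambda := (q ^+ 2 - c) / ((q - a) * q) in
  lambda ^ (1 - 2%:Z) * (fpoly 2 q a c).[x] = (q - a) * (q - c) / ((1 - q) * (c - a * q)).
Proof.
move=> aq lambda; have qa : q - a != 0 by rewrite subr_eq0 eq_sym.
have qc : q ^+ 2 - c != 0 by rewrite subr_eq0 eq_sym (hc 2).
have q10 : 1 - q != 0 by rewrite subr_eq0 eq_sym (q_not_root1 0).
have caq : c - a * q != 0.
  rewrite subr_eq0; apply: contra (hac (- 1)) => /eqP e.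
  by rewrite {1}e invfM mulrA mulfV // mul1r.
have -> : fpoly 2 q a c = ((fpoly 2 q a c)`_0)%:P.
  apply/polyP => -[|j]; rewrite coefC //=.
  by rewrite fpolyE.
rewrite hornerC fpolyE // /conv big_ord1 PpolyE // phi_coef21.
rewrite !qpochS !qpoch0 !expr0 !expr1 /lambda expq_pred // expr1.
by rewrite /=; field; rewrite caq q10 c0 q0 qa qc.
Qed.

End Evaluation.

Theorem theorem1 (R : realType) (q a c : R[i])
  (hq : 0 < `|q| < 1)
  (hc0 : c != 0) (hc : forall i : int, c != q ^ i)
  (hac0 : a / c != 0) (hac : forall i : int, a / c != q ^ i) :
  (forall (m : nat) (lambda : R[i]), (2 <= m)%N ->
     root (Ppoly m q a c) lambda ->
     (phi_converges [tuple a; q ^+ m] [tuple c] q lambda ->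
        phi [tuple a; q ^+ m] [tuple c] q lambda
        = lambda ^ (1 - m%:Z) * (fpoly m q a c).[lambda]) /\
     (phi_converges [tuple c / a; c * q ^ (- m%:Z)] [tuple c] q
          (a * q ^+ m * lambda / c) ->
        phi [tuple c / a; c * q ^ (- m%:Z)] [tuple c] q
          (a * q ^+ m * lambda / c)
        = qpoch_oo q lambda / qpoch_oo q (a * q ^+ m * lambda / c)
          * lambda ^ (1 - m%:Z) * (fpoly m q a c).[lambda])) /\
  (a != q ->
     let lambda := (q ^+ 2 - c) / ((q - a) * q) in
     (forall x : R[i], root (Ppoly 2 q a c) x <-> x = lambda) /\
     (phi_converges [tuple a; q ^+ 2] [tuple c] q
          ((q ^+ 2 - c) / ((q - a) * q)) ->
        phi [tuple a; q ^+ 2] [tuple c] q ((q ^+ 2 - c) / ((q - a) * q))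
        = (q - a) * (q - c) / ((1 - q) * (c - a * q))) /\
     (phi_converges [tuple c / a; c * q ^ (- 2%:Z)] [tuple c] q
          ((q ^+ 2 - c) * a * q / ((q - a) * c)) ->
        phi [tuple c / a; c * q ^ (- 2%:Z)] [tuple c] q
          ((q ^+ 2 - c) * a * q / ((q - a) * c))
        = qpoch_oo q lambda / qpoch_oo q (a * q ^+ 2 * lambda / c)
          * ((q - a) * (q - c) / ((1 - q) * (c - a * q))))).
Proof.
have hC := @complex_geometrically_complete R.
have a0 : a != 0 by apply: contraNneq hac0 => ->; rewrite mul0r.
have first n (x : R[i]) := @phi21_at_root R[i] q a c hC hq hc0 hc a0 hac n x.
have second n (x : R[i]) := @phi21_heine_at_root R[i] q a c hC hq hc0 hc a0 hac n x.
split=> [[//|n] x _ px | aq lambda].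
  by rewrite -exprnN; split; [exact: first | exact: second].
have rootP2 := @root_Ppoly2 R[i] q a c hq hc0 hc a0 _ aq.
have proot : root (Ppoly 2 q a c) lambda by apply/rootP2.
have value := @horner_fpoly2 R[i] q a c hq hc0 hc a0 hac lambda aq.
split; first exact: rootP2.
split=> [cv|]; first by rewrite -value first.
have -> : (q ^+ 2 - c) * a * q / ((q - a) * c) = a * q ^+ 2 * lambda / c.
  have q0 : q != 0 by rewrite -normr_gt0; case/andP: hq.
  have qa : q - a != 0 by rewrite subr_eq0 eq_sym.
  by rewrite /lambda; field; rewrite q0 qa hc0.
rewrite -exprnN => cv; rewrite second //.
by rewrite -value [RHS]mulrA.
Qed.
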